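(* Let $M_1,M_2$ be monoids with a common submonoid $W$, let $L=M_1\ast_W M_2$ be the amalgamated free product, and suppose that $\mathbb ZL$ is flat as a right $\mathbb ZM_1$-module, as a right $\mathbb ZM_2$-module and as a right $\mathbb ZW$-module. Let $d\geq 1$ be an integer. If $M_1,M_2$ have left cohomological dimension at most $d$ and $W$ has left cohomological dimension at most $d-1$, then $M_1\ast_W M_2$ has left cohomological dimension at most $d$.
   Context: $M_1\ast_W M_2$ is the pushout, in the category of monoids, of the inclusions $W\to M_1$ and $W\to M_2$; $\mathbb ZL$ is a right module over $\mathbb ZM_1$, $\mathbb ZM_2$, $\mathbb ZW$ via the canonical homomorphisms to $L$ (which need not be injective) and right multiplication. The left cohomological dimension of a monoid $M$ is the shortest length of a projective resolution of the trivial left $\mathbb ZM$-module $\mathbb Z$. *)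

(* Defs.v *)
From HB Require Import structures.
From mathcomp Require Import all_boot all_order all_algebra.
From mathcomp Require Import finmap monalg boolp.

Set Implicit Arguments.
Unset Strict Implicit.
Unset Printing Implicit Defensive.

Import GRing.Theory.

Local Open Scope ring_scope.
Local Open Scope quotient_scope.

(* [{malg K}] is the free abelian group on [K], with basis [<< k >>];
   [malg_ext b] is the additive map with [<< k >> |-> b k]. *)

Section MalgExt.
Context (K : choiceType) (G : zmodType).

Definition malg_ext (b : K -> G) (g : {malg K}) : G :=
  \sum_(k <- msupp g) b k *~ g@_k.

Lemma malg_extEw b (d : {fset K}) g : (msupp g `<=` d)%fset ->
  malg_ext b g = \sum_(k <- d) b k *~ g@_k.
Proof.
move=> le; rewrite [LHS](big_fset_incl _ le) => //= x xd /mcoeff_outdom ->.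
by rewrite mulr0z.
Qed.

Lemma malg_ext_is_zmod b : zmod_morphism (malg_ext b).
Proof.
move=> g1 g2; pose d := (msupp g1 `|` msupp g2)%fset.
rewrite (malg_extEw b (d := d)) ?msuppB_le //.
rewrite (malg_extEw b (d := d)) ?fsubsetUl //.
rewrite (malg_extEw b (d := d)) ?fsubsetUr //.
by rewrite -sumrB; apply: eq_bigr => k _; rewrite mcoeffB mulrzBr.
Qed.

HB.instance Definition _ b :=
  GRing.isZmodMorphism.Build {malg K} G (malg_ext b) (malg_ext_is_zmod b).

Lemma malg_extU b k : malg_ext b << k >> = b k.
Proof. by rewrite /malg_ext msuppU oner_eq0 big_seq_fset1 mcoeffUU. Qed.

Lemma malg_intE (g : {malg K}) : g = \sum_(k <- msupp g) << k >> *~ g@_k.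
Proof.
rewrite {1}[g]monalgE; apply: eq_bigr => k _.
by rewrite -(raddfMz (@mkmalgU K int k)) intz.
Qed.

Lemma malg_additive_ext (f1 f2 : {additive {malg K} -> G}) :
  (forall k, f1 << k >> = f2 << k >>) -> f1 =1 f2.
Proof.
move=> eqf g; rewrite [g]malg_intE !raddf_sum; apply: eq_bigr => k _.
by rewrite !raddfMz eqf.
Qed.

End MalgExt.

Lemma malg_ind (K : choiceType) (P : {malg K} -> Prop) :
    P 0 -> (forall x y, P x -> P y -> P (x - y)) -> (forall k, P << k >>) ->
  forall g, P g.
Proof.
move=> P0 PB PU g; rewrite [g]malg_intE.
have PN x : P x -> P (- x) by move=> Px; rewrite -[- x]add0r; apply: PB.
have PD x y : P x -> P y -> P (x + y).
  by move=> Px Py; rewrite -[y]opprK; apply: PB => //; apply: PN.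
elim/big_ind: _ => // k _.
have PMn n : P (<< k >> *+ n) by elim: n => // n IHn; rewrite mulrS; apply: PD.
by case: (g@_k) => n; rewrite ?NegzE ?mulrNz; [|apply: PN]; apply: PMn.
Qed.

Definition mring (M : monoidType) : Type := {malg M}.

Section MonoidRing.
Context (M : monoidType).
Implicit Types x y z : mring M.

HB.instance Definition _ := GRing.Zmodule.on (mring M).

Definition mring_mul (a b : mring M) : mring M :=
  malg_ext (fun m => malg_ext (fun n => << (m * n)%g >>) b) a.
Definition mring_one : mring M := << 1%g >>.

Lemma mring_mulBl x y z :
  mring_mul (x - y) z = mring_mul x z - mring_mul y z.
Proof. exact: (malg_ext_is_zmod _ x y). Qed.

Lemma mring_mulBr x y z :
  mring_mul x (y - z) = mring_mul x y - mring_mul x z.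
Proof.
rewrite /mring_mul /malg_ext -sumrB; apply: eq_bigr => k _.
by rewrite -mulrzBl -[in RHS](raddfB (malg_ext _)).
Qed.

Lemma mring_mul0l x : mring_mul 0 x = 0.
Proof. by rewrite -(subrr 0) mring_mulBl !subrr. Qed.

Lemma mring_mul0r x : mring_mul x 0 = 0.
Proof. by rewrite -(subrr 0) mring_mulBr !subrr. Qed.

Lemma mring_mulUU m n : mring_mul << m >> << n >> = << (m * n)%g >>.
Proof. by rewrite /mring_mul !malg_extU. Qed.

Lemma mring_mulDl : left_distributive mring_mul +%R.
Proof.
move=> x y z; have yN : mring_mul (- y) z = - mring_mul y z.
  by rewrite -[- y]add0r mring_mulBl mring_mul0l sub0r.
by rewrite -{1}[y]opprK mring_mulBl yN opprK.
Qed.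

Lemma mring_mulDr : right_distributive mring_mul +%R.
Proof.
move=> x y z; have zN : mring_mul x (- z) = - mring_mul x z.
  by rewrite -[- z]add0r mring_mulBr mring_mul0r sub0r.
by rewrite -{1}[z]opprK mring_mulBr zN opprK.
Qed.

Lemma mring_mulA : associative mring_mul.
Proof.
move=> x y z; elim/malg_ind: x => [|x1 x2 IH1 IH2|m].
- by rewrite !mring_mul0l.
- by rewrite !mring_mulBl IH1 IH2.
elim/malg_ind: y => [|y1 y2 IH1 IH2|n].
- by rewrite mring_mul0l !mring_mul0r mring_mul0l.
- by rewrite mring_mulBl !mring_mulBr IH1 IH2 mring_mulBl.
elim/malg_ind: z => [|z1 z2 IH1 IH2|p].
- by rewrite !mring_mul0r.
- by rewrite !mring_mulBr IH1 IH2.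
by rewrite !mring_mulUU mulgA.
Qed.

Lemma mring_mul1l : left_id mring_one mring_mul.
Proof.
elim/malg_ind => [|x1 x2 IH1 IH2|m]; first exact: mring_mul0r.
  by rewrite mring_mulBr IH1 IH2.
by rewrite mring_mulUU mul1g.
Qed.

Lemma mring_mul1r : right_id mring_one mring_mul.
Proof.
elim/malg_ind => [|x1 x2 IH1 IH2|m]; first exact: mring_mul0l.
  by rewrite mring_mulBl IH1 IH2.
by rewrite mring_mulUU mulg1.
Qed.

Lemma mring_one_neq0 : mring_one != 0.
Proof. by rewrite monalgU_eq0 oner_eq0. Qed.

HB.instance Definition _ := GRing.Zmodule_isNzRing.Build (mring M)
  mring_mulA mring_mul1l mring_mul1r mring_mulDl mring_mulDr mring_one_neq0.

End MonoidRing.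

Notation monoid_hom := UMagmaMorphism.type.

Section MonoidRingMap.
Context (M N : monoidType) (h : monoid_hom M N).

Definition mring_map (a : mring M) : mring N :=
  malg_ext (fun m => << h m >> : mring N) a.

Lemma mring_map_is_zmod : zmod_morphism mring_map.
Proof. exact: malg_ext_is_zmod. Qed.

HB.instance Definition _ :=
  GRing.isZmodMorphism.Build (mring M) (mring N) mring_map mring_map_is_zmod.

Lemma mring_map_is_monoid : GRing.monoid_morphism mring_map.
Proof.
split=> [|x y]; first by rewrite /mring_map malg_extU gmulf1.
elim/malg_ind: x => [|x1 x2 IH1 IH2|m].
- by rewrite mul0r !raddf0 mul0r.
- by rewrite mulrBl !raddfB /= mulrBl IH1 IH2.
elim/malg_ind: y => [|y1 y2 IH1 IH2|n].
- by rewrite mulr0 !raddf0 mulr0.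
- by rewrite mulrBr !raddfB /= mulrBr IH1 IH2.
rewrite [_ * _]mring_mulUU /mring_map !malg_extU gmulfM.
exact/esym/mring_mulUU.
Qed.

HB.instance Definition _ :=
  GRing.isMonoidMorphism.Build (mring M) (mring N) mring_map mring_map_is_monoid.

End MonoidRingMap.

Section Augmentation.
Context (M : monoidType).

Definition mring_aug (a : mring M) : int := malg_ext (fun=> 1) a.

Lemma mring_aug_is_zmod : zmod_morphism mring_aug.
Proof. exact: malg_ext_is_zmod. Qed.

HB.instance Definition _ :=
  GRing.isZmodMorphism.Build (mring M) int mring_aug mring_aug_is_zmod.

Lemma mring_aug_is_monoid : GRing.monoid_morphism mring_aug.
Proof.
split=> [|x y]; first by rewrite /mring_aug malg_extU.
elim/malg_ind: x => [|x1 x2 IH1 IH2|m].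
- by rewrite mul0r !raddf0 mul0r.
- by rewrite mulrBl !raddfB /= mulrBl IH1 IH2.
elim/malg_ind: y => [|y1 y2 IH1 IH2|n].
- by rewrite mulr0 !raddf0 mulr0.
- by rewrite mulrBr !raddfB /= mulrBr IH1 IH2.
by rewrite [_ * _]mring_mulUU /mring_aug !malg_extU.
Qed.

HB.instance Definition _ :=
  GRing.isMonoidMorphism.Build (mring M) int mring_aug mring_aug_is_monoid.

End Augmentation.

Definition trivial_mod (M : monoidType) : Type := int.

Section TrivialModule.
Context (M : monoidType).

HB.instance Definition _ := GRing.Zmodule.on (trivial_mod M).

Definition trivial_scale (a : mring M) (n : trivial_mod M) : trivial_mod M :=
  (mring_aug a * n)%R : int.

Lemma trivial_scaleA a b n :
  trivial_scale a (trivial_scale b n) = trivial_scale (a * b) n.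
Proof. by rewrite /trivial_scale rmorphM mulrA. Qed.

Lemma trivial_scale1 : left_id 1 trivial_scale.
Proof. by move=> n; rewrite /trivial_scale rmorph1 mul1r. Qed.

Lemma trivial_scaleDr : right_distributive trivial_scale +%R.
Proof. by move=> a m n; apply: mulrDr. Qed.

Lemma trivial_scaleDl n : {morph trivial_scale^~ n : a b / a + b}.
Proof. by move=> a b; rewrite /trivial_scale rmorphD; apply: mulrDl. Qed.

HB.instance Definition _ :=
  GRing.Zmodule_isLmodule.Build (mring M) (trivial_mod M)
    trivial_scaleA trivial_scale1 trivial_scaleDr trivial_scaleDl.

End TrivialModule.

(* A right [R]-module is an [lmodType R^c]; there [r *: x] stands for [x r]. *)

Section Tensor.
Context (R : nzRingType) (F : lmodType R^c) (A : lmodType R).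

Inductive tensor_rel : {malg (F * A)%type} -> Prop :=
| tensor_rel0 : tensor_rel 0
| tensor_relB z w : tensor_rel z -> tensor_rel w -> tensor_rel (z - w)
| tensor_relDl x y a :
    tensor_rel (<< (x + y, a) >> - (<< (x, a) >> + << (y, a) >>))
| tensor_relDr x a b :
    tensor_rel (<< (x, a + b) >> - (<< (x, a) >> + << (x, b) >>))
| tensor_relZ (r : R) x a :
    tensor_rel (<< ((r : R^c) *: x, a) >> - << (x, r *: a) >>).

Definition tensor_pred : {pred {malg (F * A)%type}} :=
  fun z => `[< tensor_rel z >].

Lemma tensor_pred_closed : zmod_closed tensor_pred.
Proof.
split=> [|z w /asboolP zR /asboolP wR]; apply/asboolP.
  exact: tensor_rel0.
exact: tensor_relB.
Qed.

HB.instance Definition _ :=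
  GRing.isZmodClosed.Build {malg (F * A)%type} tensor_pred tensor_pred_closed.

Definition tensor : Type := Quotient.quot tensor_pred.

HB.instance Definition _ := GRing.Zmodule.on tensor.

Definition tens (x : F) (a : A) : tensor :=
  \pi_(Quotient.quot tensor_pred) << (x, a) >>.

Definition balanced (G : zmodType) (b : F -> A -> G) : Prop :=
  [/\ forall x y a, b (x + y) a = b x a + b y a,
      forall x a c, b x (a + c) = b x a + b x c &
      forall (r : R) x a, b ((r : R^c) *: x) a = b x (r *: a)].

Definition tensor_lift (G : zmodType) (b : F -> A -> G) (t : tensor) : G :=
  malg_ext (fun p => b p.1 p.2) (repr (t : Quotient.quot tensor_pred)).

Lemma tensor_pi_eq z w : tensor_rel (z - w) ->
  \pi_(Quotient.quot tensor_pred) z = \pi_(Quotient.quot tensor_pred) w.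
Proof. by move=> zw; apply/eqP; rewrite -Quotient.idealrBE; apply/asboolP. Qed.

Lemma tensor_pi_rel z w :
  \pi_(Quotient.quot tensor_pred) z = \pi_(Quotient.quot tensor_pred) w ->
  tensor_rel (z - w).
Proof. by move/eqP; rewrite -Quotient.idealrBE => /asboolP. Qed.

Lemma tens_balanced : balanced tens.
Proof.
split=> [x y a|x a b|r x a]; rewrite /tens.
- by rewrite -[RHS]Quotient.pi_add; apply: tensor_pi_eq; apply: tensor_relDl.
- by rewrite -[RHS]Quotient.pi_add; apply: tensor_pi_eq; apply: tensor_relDr.
- by apply: tensor_pi_eq; apply: tensor_relZ.
Qed.

Section Lift.
Context (G : zmodType) (b : F -> A -> G).
Hypothesis b_bal : balanced b.

Lemma tensor_lift_pi z :
  tensor_lift b (\pi_(Quotient.quot tensor_pred) z) =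
  malg_ext (fun p => b p.1 p.2) z.
Proof.
have rel0 w : tensor_rel w -> malg_ext (fun p => b p.1 p.2) w = 0.
  have [bDl bDr bZ] := b_bal.
  elim=> [|{}w v _ IHw _ IHv|x y a|x a c|r x a].
  - by rewrite raddf0.
  - by rewrite raddfB /= IHw IHv subrr.
  - by rewrite raddfB raddfD /= !malg_extU /= bDl subrr.
  - by rewrite raddfB raddfD /= !malg_extU /= bDr subrr.
  - by rewrite raddfB /= !malg_extU /= bZ subrr.
apply/eqP; rewrite -subr_eq0 /tensor_lift -raddfB /=; apply/eqP/rel0.
by apply: tensor_pi_rel; rewrite reprK.
Qed.

Lemma tensor_liftE x a : tensor_lift b (tens x a) = b x a.
Proof. by rewrite tensor_lift_pi malg_extU. Qed.

Lemma tensor_lift_is_zmod : zmod_morphism (tensor_lift b).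
Proof.
move=> t u; rewrite -[t]reprK -[u]reprK.
have <- : \pi_(Quotient.quot tensor_pred) (repr t - repr u) =
    \pi_(Quotient.quot tensor_pred) (repr t)
    - \pi_(Quotient.quot tensor_pred) (repr u) :> tensor.
  by rewrite Quotient.pi_add Quotient.pi_opp.
by rewrite !tensor_lift_pi raddfB.
Qed.

End Lift.

Lemma tensor_additive_ext (G : zmodType) (f1 f2 : {additive tensor -> G}) :
  (forall x a, f1 (tens x a) = f2 (tens x a)) -> f1 =1 f2.
Proof.
move=> eqf t; rewrite -[t]reprK.
elim/malg_ind: (repr t) => [|z w IHz IHw|[x a]]; last exact: eqf.
- have -> : \pi_(Quotient.quot tensor_pred) 0 = 0 :> tensor.
    by rewrite /GRing.zero /= /Quotient.zero; unlock.
  by rewrite !raddf0.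
- have -> : \pi_(Quotient.quot tensor_pred) (z - w) =
    \pi_(Quotient.quot tensor_pred) z
    - \pi_(Quotient.quot tensor_pred) w :> tensor.
    by rewrite Quotient.pi_add Quotient.pi_opp.
  by rewrite !raddfB IHz IHw.
Qed.

End Tensor.

Arguments tensor {R} F A.

Section TensorMap.
Context (R : nzRingType) (F : lmodType R^c) (A B : lmodType R).
Context (f : {linear A -> B}).

Lemma tensor_map_balanced : balanced (fun (x : F) a => tens x (f a)).
Proof.
have [tDl tDr tZ] := @tens_balanced _ F B.
by split=> [x y a|x a c|r x a]; rewrite ?tDl ?linearD ?tDr ?tZ ?linearZ.
Qed.

Definition tensor_map : tensor F A -> tensor F B :=
  tensor_lift (fun x a => tens x (f a)).

HB.instance Definition _ :=
  GRing.isZmodMorphism.Build (tensor F A) (tensor F B) tensor_map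
    (tensor_lift_is_zmod tensor_map_balanced).

Lemma tensor_mapE x a : tensor_map (tens x a) = tens x (f a).
Proof. exact: (tensor_liftE tensor_map_balanced). Qed.

End TensorMap.

Arguments tensor_map {R} F {A B} f.

Definition flat (R : nzRingType) (F : lmodType R^c) : Prop :=
  forall (A B : lmodType R) (f : {linear A -> B}),
    injective f -> injective (tensor_map F f).

Definition rmod_via (R S : nzRingType) (phi : {rmorphism R -> S}) : Type := S.

Section RightModuleVia.
Context (R S : nzRingType) (phi : {rmorphism R -> S}).

HB.instance Definition _ := GRing.Zmodule.on (rmod_via phi).

Definition rmod_scale (r : R^c) (x : rmod_via phi) : rmod_via phi :=
  (x : S) * phi r.

Lemma rmod_scaleA r s x : rmod_scale r (rmod_scale s x) = rmod_scale (r * s) x.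
Proof. by rewrite /rmod_scale -mulrA -rmorphM. Qed.

Lemma rmod_scale1 : left_id 1 rmod_scale.
Proof. by move=> x; rewrite /rmod_scale rmorph1 mulr1. Qed.

Lemma rmod_scaleDr : right_distributive rmod_scale +%R.
Proof. by move=> r x y; apply: mulrDl. Qed.

Lemma rmod_scaleDl x : {morph rmod_scale^~ x : r s / r + s}.
Proof. by move=> r s; rewrite /rmod_scale rmorphD; apply: mulrDr. Qed.

HB.instance Definition _ :=
  GRing.Zmodule_isLmodule.Build R^c (rmod_via phi)
    rmod_scaleA rmod_scale1 rmod_scaleDr rmod_scaleDl.

End RightModuleVia.

Definition projective (R : nzRingType) (P : lmodType R) : Prop :=
  forall (A B : lmodType R) (g : {linear A -> B}) (h : {linear P -> B}),
    (forall b, exists a, g a = b) ->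
    exists k : {linear P -> A}, forall x, g (k x) = h x.

Record proj_resolution (R : nzRingType) (N : lmodType R) := ProjResolution {
  res_mod :> nat -> lmodType R;
  res_d : forall i, {linear res_mod i.+1 -> res_mod i};
  res_eps : {linear res_mod 0%N -> N};
  res_proj : forall i, projective (res_mod i);
  res_surj : forall y : N, exists x, res_eps x = y;
  res_exact0 : forall x, res_eps x = 0 <-> exists y, res_d 0%N y = x;
  res_exactS : forall i x, res_d i x = 0 <-> exists y, res_d i.+1 y = x
}.

(* A resolution of finite length is continued by zero modules; its length is
   the largest degree of a nonzero term. *)
Definition length_at_most (R : nzRingType) (N : lmodType R)
    (P : proj_resolution N) (n : nat) : Prop :=
  forall i, (n < i)%N -> forall x : P i, x = 0.

(* The dimension (the shortest length of a resolution) may be infinite, so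
   only the relation [cd M <= n] is defined. *)
Definition left_cd_le (M : monoidType) (n : nat) : Prop :=
  exists P : proj_resolution (trivial_mod M), length_at_most P n.

Definition is_pushout (W M1 M2 L : monoidType)
    (j1 : monoid_hom W M1) (j2 : monoid_hom W M2)
    (i1 : monoid_hom M1 L) (i2 : monoid_hom M2 L) : Prop :=
  i1 \o j1 =1 i2 \o j2 /\
  forall (N : monoidType) (f1 : monoid_hom M1 N) (f2 : monoid_hom M2 N),
    f1 \o j1 =1 f2 \o j2 ->
    exists h : monoid_hom L N, [/\ h \o i1 =1 f1, h \o i2 =1 f2 &
      forall h' : monoid_hom L N, h' \o i1 =1 f1 -> h' \o i2 =1 f2 -> h' =1 h].

(* Main.v *)
(* Write [E = ZL (x)_W Z] and [Vi = ZL (x)_Mi Z], where [Z] is the trivial module.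
   The sequence of [ZL]-modules [0 -> E -> V1 x V2 -> Z -> 0] is exact. Indeed the
   universal property of [L], applied to the monoids [A >< L], determines the
   derivations from [L] to an [L]-module [A] by their restrictions to [M1] and [M2];
   the derivation [D : L -> E] with [D m1 = m1 (x) 1 - 1 (x) 1] and [D m2 = 0] gives
   additive maps [V1 -> E], [l (x) 1 |-> l (x) 1 - D l], and [V2 -> E],
   [l (x) 1 |-> D l], that split the sequence. By flatness, base change to [ZL]
   sends projective resolutions of [Z] over [ZW], [ZM1], [ZM2] to projective
   resolutions of [E], [V1], [V2], and the mapping cone of a lift of [E -> V1 x V2]
   to these is a resolution of [Z] over [ZL] of length at most [d]. *)
Require Import Defs.
From HB Require Import structures.
From mathcomp Require Import all_boot all_order all_algebra.
From mathcomp Require Import monalg boolp.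

Set Implicit Arguments.
Unset Strict Implicit.
Unset Printing Implicit Defensive.

Import GRing.Theory.

Local Open Scope ring_scope.
Local Open Scope quotient_scope.

(** * Linear maps, images and projective modules *)

Definition linear_of (R : nzRingType) (A B : lmodType R) (f : A -> B)
    (fL : linear f) : {linear A -> B} :=
  HB.pack f (GRing.isLinear.Build R A B *:%R f fL).

Section Image.
Context (R : nzRingType) (A B : lmodType R) (g : {linear A -> B}).

Definition lin_image_pred : {pred B} := fun b => `[< exists a, g a = b >].

Lemma lin_image_pred_closed : submod_closed lin_image_pred.
Proof.
split=> [|r _ _ /asboolP[a <-] /asboolP[b <-]]; apply/asboolP.
  by exists 0; rewrite linear0.
by exists (r *: a + b); rewrite linearP.
Qed.

HB.instance Definition _ :=
  GRing.isSubmodClosed.Build R B lin_image_pred lin_image_pred_closed.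

(** Projectivity lifts along surjections and flatness speaks of injections; the image as a module
    factors any [g] into one of each. *)
Record lin_image :=
  LinImage { lin_image_val : B; _ : lin_image_val \in lin_image_pred }.

HB.instance Definition _ := [isSub for lin_image_val].
HB.instance Definition _ := [Choice of lin_image by <:].
HB.instance Definition _ := [SubChoice_isSubLmodule of lin_image by <:].

Lemma lin_imageP (y : lin_image) : exists a, g a = val y.
Proof. exact/asboolP/(valP y). Qed.

Section Corestriction.
Context (C : lmodType R) (f : {linear C -> B}).
Hypothesis f_image : forall x, exists a, g a = f x.

Definition corestrict x : lin_image := Sub (f x) (asboolT (f_image x)).

Lemma corestrict_linear : linear corestrict.
Proof.
move=> r x y; apply: val_inj.
by rewrite linearP /= linearP.
Qed.

Definition corestrict_lin := linear_of corestrict_linear.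

End Corestriction.

End Image.

(** Corestricted to its image, [g] becomes surjective, and [h] still lands there by hypothesis. *)
Lemma projective_lift (R : nzRingType) (P A B : lmodType R)
    (g : {linear A -> B}) (h : {linear P -> B}) :
  projective P -> (forall x, exists a, g a = h x) ->
  exists k : {linear P -> A}, forall x, g (k x) = h x.
Proof.
move=> Pproj him; have gim x : exists a, g a = g x by exists x.
have [b|k kE] := Pproj _ _ (corestrict_lin gim) (corestrict_lin him).
  by have [a ga] := lin_imageP b; exists a; apply: val_inj.
by exists k => x; have /(congr1 val) := kE x.
Qed.

Lemma projective_prod (R : nzRingType) (P Q : lmodType R) :
  projective P -> projective Q -> projective (P * Q)%type.
Proof.
move=> Pproj Qproj A B g h g_surj.
have inlL : linear (fun x : P => (x, 0 : Q)).
  by move=> r x y; congr (_, _); rewrite /= scaler0 addr0.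
have inrL : linear (fun y : Q => (0 : P, y)).
  by move=> r x y; congr (_, _); rewrite /= scaler0 addr0.
have [k kE] := Pproj _ _ g (h \o linear_of inlL) g_surj.
have [l lE] := Qproj _ _ g (h \o linear_of inrL) g_surj.
have klL : linear (fun z : P * Q => k z.1 + l z.2).
  by move=> r x y; rewrite !linearP /= scalerDr addrACA.
exists (linear_of klL) => -[x y].
rewrite /= linearD kE lE /= -linearD; congr (h (_, _)); first exact: addr0.
exact: add0r.
Qed.

(** * Cycles and direct products of resolutions *)

Section ResolutionCycles.
Context (R : nzRingType) (N : lmodType R) (P : proj_resolution N).

(** In degree 0 the augmentation takes the place of a differential; this case split makes exactness
    one statement for all degrees. *)
Definition res_cycle i : P i -> Prop :=
  match i with
  | 0 => fun x => res_eps P x = 0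
  | j.+1 => fun x => res_d P j x = 0
  end.

Lemma res_cycleP i (x : P i) : res_cycle x <-> exists y, res_d P i y = x.
Proof. by case: i x => [|i] x; [apply: res_exact0 | apply: res_exactS]. Qed.

Lemma res_cycle_d i (x : P i.+1) : res_cycle (res_d P i x).
Proof. by apply/res_cycleP; exists x. Qed.

End ResolutionCycles.

Section ProductResolution.
Context (R : nzRingType) (M N : lmodType R).
Context (P : proj_resolution M) (Q : proj_resolution N).

Lemma pair_linear (A B C D : lmodType R) (f : {linear A -> B})
  (g : {linear C -> D}) : linear (fun z : A * C => (f z.1, g z.2)).
Proof. by move=> r x y; congr (_, _); rewrite /= linearP. Qed.

Definition prod_res : proj_resolution (M * N)%type.
Proof.
apply: (@ProjResolution R (M * N)%type (fun i => (P i * Q i)%type)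
  (fun i => linear_of (pair_linear (res_d P i) (res_d Q i)))
  (linear_of (pair_linear (res_eps P) (res_eps Q)))).
- by move=> i; apply: projective_prod; apply: res_proj.
- move=> [y z]; have [x <-] := res_surj P y; have [x' <-] := res_surj Q z.
  by exists (x, x').
- move=> [x x']; split=> [[/res_exact0[y <-] /res_exact0[y' <-]]|[[y y'] [<- <-]]].
    by exists (y, y').
  by congr (_, _); apply/res_exact0; [exists y|exists y'].
- move=> i [x x']; split=> [[/res_exactS[y <-] /res_exactS[y' <-]]|].
    by exists (y, y').
  move=> [[y y'] [<- <-]].
  by congr (_, _); apply/res_exactS; [exists y|exists y'].
Defined.

Lemma prod_res_length n : length_at_most P n -> length_at_most Q n ->
  length_at_most prod_res n.
Proof. by move=> lP lQ i lt_ni [x y]; rewrite (lP i _ x) // (lQ i _ y). Qed.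

End ProductResolution.

(** * The mapping cone of a lift to resolutions *)

Section MappingCone.
Context (R : nzRingType) (A B C : lmodType R).
Context (alpha : {linear A -> B}) (beta : {linear B -> C}).
Hypothesis alpha_inj : injective alpha.
Hypothesis exact_mid : forall y, beta y = 0 <-> exists x, alpha x = y.
Hypothesis beta_surj : forall z, exists y, beta y = z.
Context (P : proj_resolution A) (Q : proj_resolution B).

(** Comparison theorem: a map that preserves cycles sends boundaries of [P] to cycles of [Q], which
    are boundaries by exactness, so projectivity of the next term of [P] yields the next map. *)
Lemma chain_lift : exists f : forall i, {linear P i -> Q i},
  (forall x, res_eps Q (f 0%N x) = alpha (res_eps P x)) /\
  forall i x, res_d Q i (f i.+1 x) = f i (res_d P i x).
Proof.
have [f0 f0E] : exists f0 : {linear P 0%N -> Q 0%N},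
    forall x, res_eps Q (f0 x) = alpha (res_eps P x).
  apply: (projective_lift (h := alpha \o res_eps P)) => [|x].
    exact: res_proj.
  exact: res_surj.
(* The recursion carries preservation of cycles along; [cid] below turns the existence of the next
   map into a choice of it. *)
pose T i := {f : {linear P i -> Q i} | forall x, res_cycle x -> res_cycle (f x)}.
have f0T x : res_cycle x -> res_cycle (f0 x).
  by rewrite /= f0E => ->; rewrite linear0.
have step i (f : T i) :
    {g : T i.+1 | forall x, res_d Q i (sval g x) = sval f (res_d P i x)}.
  apply: cid; case: f => f fT /=.
  have [|x|g gE] := @projective_lift _ (P i.+1) _ _ (res_d Q i) (f \o res_d P i).
  - exact: res_proj.
  - exact/res_cycleP/fT/res_cycle_d.
  have gT x : res_cycle x -> res_cycle (g x).
    by move=> /= xZ; rewrite gE /= xZ linear0.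
  by exists (exist _ g gT).
pose F := nat_rect T (exist _ f0 f0T) (fun i f => sval (step i f)).
exists (fun i => sval (F i)); split=> // i x.
exact: (svalP (step i (F i))).
Qed.

Section Cone.
Context (f : forall i, {linear P i -> Q i}).
Hypothesis f_eps : forall x, res_eps Q (f 0%N x) = alpha (res_eps P x).
Hypothesis f_d : forall i x, res_d Q i (f i.+1 x) = f i (res_d P i x).

(** [P] is shifted up by one, so degree 0 contains [Q] alone and the cone is augmented to [C] by
    [beta \o res_eps Q]. *)
Definition cone_mod i : lmodType R :=
  match i with 0 => Q 0%N | j.+1 => (Q j.+1 * P j)%type end.

Lemma cone_d0_linear :
  linear (fun z : Q 1%N * P 0%N => res_d Q 0%N z.1 + f 0%N z.2).
Proof. by move=> r x y; rewrite !linearP /= scalerDr addrACA. Qed.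

Lemma cone_dS_linear i : linear (fun z : Q i.+2 * P i.+1 =>
  (res_d Q i.+1 z.1 + f i.+1 z.2, - res_d P i z.2)).
Proof.
move=> r x y; congr (_, _); rewrite /= !linearP //=.
by rewrite scalerDr addrACA.
Qed.

Definition cone_d i : {linear cone_mod i.+1 -> cone_mod i} :=
  match i with
  | 0 => linear_of cone_d0_linear
  | j.+1 => linear_of (@cone_dS_linear j)
  end.

Definition cone_res : proj_resolution C.
Proof.
apply: (@ProjResolution R C cone_mod cone_d (beta \o res_eps Q)).
- by case=> [|i]; [|apply: projective_prod]; apply: res_proj.
- move=> z; have [y <-] := beta_surj z; have [x <-] := res_surj Q y.
  by exists x.
- move=> x /=; split=> [/exact_mid[a ax]|[[q p] /= <-]].
    (* [x] and [f 0%N p] have the same image [alpha a] in [B], so their difference is a boundary of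
       [Q]. *)
    have [p pE] := res_surj P a.
    have /res_exact0[q qE] : res_eps Q (x - f 0%N p) = 0.
      by rewrite linearB f_eps pE ax subrr.
    by exists (q, p); rewrite /= qE subrK.
  have /= dq := @res_cycle_d _ _ Q 0%N q.
  by apply/exact_mid; exists (res_eps P p); rewrite linearD dq add0r f_eps.
(* With [p] the boundary of [p'], the element [q + f i.+1 p'] is a cycle by [f_d], hence a boundary.
   The witness is [- p'] because the differential of the cone has a sign on [P]. *)
- have cone_exact i (q : Q i.+1) (p : P i) : res_cycle p ->
      res_d Q i q + f i p = 0 ->
      exists q' p', res_d Q i.+1 q' + f i.+1 p' = q /\ - res_d P i p' = p.
    move=> /res_cycleP[p' <-] qp.
    have /res_exactS[q' q'E] : res_d Q i (q + f i.+1 p') = 0.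
      by rewrite linearD f_d.
    by exists q', (- p'); rewrite !linearN q'E opprK addrK.
  case=> [|i] [q p]; split.
  (* In the lowest case the cycle condition on [p] is not part of the kernel equation: [res_eps Q]
     turns [qp] into [alpha (res_eps P p) = 0], and [alpha] is injective. *)
  + move=> /= qp; have pZ : res_cycle p.
      move/(congr1 (res_eps Q)): (qp).
      have /= dq := @res_cycle_d _ _ Q 0%N q.
      rewrite linearD dq add0r linear0 f_eps => ap.
      by apply: alpha_inj; rewrite ap linear0.
    by have [q' [p' [<- <-]]] := cone_exact 0%N q p pZ qp; exists (q', p').
  + move=> [[q' p'] [<- <-]] /=.
    have /= dq := @res_cycle_d _ _ Q 1%N q'.
    by rewrite linearD dq add0r f_d linearN subrr.
  + move=> [qp /eqP]; rewrite oppr_eq0 => /eqP pZ.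
    have [q' [p' [<- <-]]] := cone_exact i.+1 q p pZ qp.
    by exists (q', p').
  + move=> [[q' p'] [<- <-]] /=.
    have /= dq := @res_cycle_d _ _ Q i.+2 q'.
    have /= dp := @res_cycle_d _ _ P i.+1 p'.
    by congr (_, _); rewrite !(linearD, linearN) ?dq /= ?f_d ?add0r ?subrr ?dp ?oppr0.
Defined.

End Cone.

Lemma mapping_cone n : length_at_most P n -> length_at_most Q n.+1 ->
  exists S : proj_resolution C, length_at_most S n.+1.
Proof.
move=> lP lQ; have [f [f_eps f_d]] := chain_lift.
exists (cone_res f_eps f_d) => -[//|i] lt_ni [q p].
by rewrite (lQ i.+1 _ q) // (lP i _ p).
Qed.

End MappingCone.

(** * Exactness of the tensor product *)

Section QuotientProjection.
Context (G : zmodType) (I : zmodClosed G).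

Definition quot_pi : {additive G -> Quotient.quot I} :=
  \pi_(Quotient.quot I).

Lemma quot_piP x y : quot_pi x = quot_pi y <-> x - y \in I.
Proof. by rewrite Quotient.idealrBE; split=> [->|/eqP]. Qed.

End QuotientProjection.

Section TensorExactness.
Context (R : nzRingType) (F : lmodType R^c).

Lemma tensor_ind (A : lmodType R) (X : tensor F A -> Prop) :
    X 0 -> (forall t u, X t -> X u -> X (t - u)) -> (forall x a, X (tens x a)) ->
  forall t, X t.
Proof.
move=> X0 XB XT t; rewrite -[t]reprK.
elim/malg_ind: (repr t) => [|z w IHz IHw|[x a]]; last exact: XT.
  by change (X (quot_pi (@tensor_pred R F A) 0)); rewrite raddf0.
by change (X (quot_pi (@tensor_pred R F A) (z - w))); rewrite raddfB; apply: XB.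
Qed.

Lemma tensor_lift_additive (A : lmodType R) (G : zmodType) (b : F -> A -> G) :
  balanced b -> exists h : {additive tensor F A -> G},
    forall x a, h (tens x a) = b x a.
Proof.
move=> b_bal; pose hP := tensor_lift_is_zmod b_bal.
pose h : {additive tensor F A -> G} := HB.pack (tensor_lift b)
  (GRing.isZmodMorphism.Build (tensor F A) G (tensor_lift b) hP).
by exists h; apply: tensor_liftE.
Qed.

Lemma tens0r (A : lmodType R) (x : F) : tens x (0 : A) = 0.
Proof.
have [_ tDr _] := @tens_balanced _ F A.
by apply: (addrI (tens x 0)); rewrite -tDr !addr0.
Qed.

Lemma tensNr (A : lmodType R) (x : F) (a : A) : tens x (- a) = - tens x a.
Proof.
have [_ tDr _] := @tens_balanced _ F A.
by apply: (addrI (tens x a)); rewrite -tDr !subrr tens0r.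
Qed.

Lemma tensor_map_surj (A B : lmodType R) (f : {linear A -> B}) :
  (forall b, exists a, f a = b) -> forall t, exists u, tensor_map F f u = t.
Proof.
move=> f_surj; elim/tensor_ind => [|t u [t' <-] [u' <-]|x b].
- by exists 0; rewrite raddf0.
- by exists (t' - u'); rewrite raddfB.
- by have [a <-] := f_surj b; exists (tens x a); rewrite tensor_mapE.
Qed.

Lemma tensor_map_comp0 (A B C : lmodType R) (f : {linear A -> B})
    (g : {linear B -> C}) :
  (forall a, g (f a) = 0) -> forall t, tensor_map F g (tensor_map F f t) = 0.
Proof.
move=> gf0; elim/tensor_ind => [|t u IHt IHu|x a]; first by rewrite !raddf0.
  by rewrite !raddfB /= IHt IHu subrr.
by rewrite !tensor_mapE gf0 tens0r.
Qed.

Section RightExact.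
Context (A B C : lmodType R) (f : {linear A -> B}) (g : {linear B -> C}).
Hypothesis g_surj : forall c, exists b, g b = c.
Hypothesis exact_mid : forall b, g b = 0 <-> exists a, f a = b.

Definition tensor_image : {pred tensor F B} :=
  fun t => `[< exists u, tensor_map F f u = t >].

Lemma tensor_image_closed : zmod_closed tensor_image.
Proof.
split=> [|_ _ /asboolP[t <-] /asboolP[u <-]]; apply/asboolP.
  by exists 0; rewrite raddf0.
by exists (t - u); rewrite raddfB.
Qed.

HB.instance Definition _ :=
  GRing.isZmodClosed.Build (tensor F B) tensor_image tensor_image_closed.

(* The inverse of [coker (F (x) f) -> F (x) C] sends [x (x) c] to the class of
   [x (x) b] for any [b] over [c]. *)
Lemma tensor_right_exact t :
  tensor_map F g t = 0 -> exists u, tensor_map F f u = t.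
Proof.
have [tDl tDr tZ] := @tens_balanced _ F B.
pose pi := quot_pi tensor_image.
have pi_eq (x : F) b b' : g b = g b' -> pi (tens x b) = pi (tens x b').
  move=> gbb'; apply/quot_piP/asboolP.
  have /exact_mid[a fa] : g (b - b') = 0 by rewrite linearB gbb' subrr.
  by exists (tens x a); rewrite tensor_mapE fa tDr tensNr.
(* [s] is a set-theoretic choice; additivity and balancedness are obtained for the classes, through
   [pi_eq]. *)
pose s c := sval (cid (g_surj c)).
have sK c : g (s c) = c by exact: svalP (cid (g_surj c)).
have sec_bal : balanced (fun (x : F) c => pi (tens x (s c))).
  split=> [x y a|x a c|r x a]; first by rewrite tDl raddfD.
    by rewrite -raddfD -tDr; apply: pi_eq; rewrite linearD !sK.
  by rewrite tZ; apply: pi_eq; rewrite linearZ /= !sK.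
have [h1 h1_tens] := tensor_lift_additive sec_bal.
have h1E : forall u, h1 (tensor_map F g u) = pi u.
  elim/tensor_ind => [|u v IHu IHv|x b].
  - by rewrite !raddf0.
  - by rewrite !raddfB /= IHu IHv.
  - by rewrite tensor_mapE h1_tens; apply: pi_eq; rewrite sK.
move=> gt; have: pi t = pi 0 by rewrite -!h1E gt !raddf0.
by move/quot_piP; rewrite subr0 => /asboolP.
Qed.

End RightExact.

(** Right exactness applies to [A -> B -> im g -> 0], and flatness makes [F (x) im g -> F (x) C]
    injective, so passing from [im g] to [C] does not enlarge the kernel. *)
Lemma flat_exact (A B C : lmodType R) (f : {linear A -> B})
    (g : {linear B -> C}) :
  flat F -> (forall b, g b = 0 <-> exists a, f a = b) ->
  forall t, tensor_map F g t = 0 <-> exists u, tensor_map F f u = t.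
Proof.
move=> F_flat fg t; split=> [gt|[u <-]]; last first.
  by apply: tensor_map_comp0 => a; apply/fg; exists a.
have gim x : exists a, g a = g x by exists x.
pose v : {linear lin_image g -> C} := \val.
have v_inj : injective v by exact: val_inj.
apply: (@tensor_right_exact _ _ _ f (corestrict_lin gim)).
- by move=> y; have [b gb] := lin_imageP y; exists b; apply: val_inj.
- move=> b; rewrite -fg; split=> [/(congr1 val)|gb]; first by [].
  exact: val_inj.
apply: (F_flat _ _ v v_inj); rewrite raddf0 -gt.
elim/tensor_ind: (t) => [|u w IHu IHw|x b]; first by rewrite !raddf0.
  by rewrite !raddfB /= IHu IHw.
by rewrite !tensor_mapE.
Qed.

End TensorExactness.

(** * Base change along a ring homomorphism *)

Definition base_change (R S : nzRingType) (phi : {rmorphism R -> S})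
  (A : lmodType R) : Type := tensor (rmod_via phi) A.

Section BaseChange.
Context (R S : nzRingType) (phi : {rmorphism R -> S}) (A : lmodType R).
Local Notation F := (rmod_via phi).

HB.instance Definition _ := GRing.Zmodule.on (base_change phi A).

Lemma base_scale_balanced (s : S) :
  balanced (fun (x : F) (a : A) => tens (s * (x : S) : F) a).
Proof.
have [tDl tDr tZ] := @tens_balanced _ F A.
split=> [x y a|x a b|r x a]; first by rewrite -tDl -mulrDr.
  exact: tDr.
by rewrite -tZ; congr tens; apply: mulrA.
Qed.

Definition base_scale (s : S) (t : base_change phi A) : base_change phi A :=
  tensor_lift (fun (x : F) (a : A) => tens (s * (x : S) : F) a) t.

Lemma base_scale_is_zmod s : zmod_morphism (base_scale s).
Proof. exact: (tensor_lift_is_zmod (base_scale_balanced s)). Qed.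

HB.instance Definition _ s :=
  GRing.isZmodMorphism.Build (base_change phi A) (base_change phi A)
    (base_scale s) (base_scale_is_zmod s).

Lemma base_scale_tens (s : S) (x : F) (a : A) :
  base_scale s (tens x a) = tens (s * (x : S) : F) a.
Proof. exact: (tensor_liftE (base_scale_balanced s)). Qed.

Lemma base_scaleA s s' t : base_scale s (base_scale s' t) = base_scale (s * s') t.
Proof.
elim/tensor_ind: t => [|t u IHt IHu|x a]; first by rewrite !raddf0.
  by rewrite !raddfB /= IHt IHu.
by rewrite !base_scale_tens mulrA.
Qed.

Lemma base_scale1 : left_id 1 base_scale.
Proof.
elim/tensor_ind => [|t u IHt IHu|x a]; first by rewrite !raddf0.
  by rewrite !raddfB /= IHt IHu.
by rewrite base_scale_tens mul1r.
Qed.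

Lemma base_scaleDr : right_distributive base_scale +%R.
Proof. by move=> s t u; rewrite raddfD. Qed.

Lemma base_scaleDl t : {morph base_scale^~ t : s s' / s + s'}.
Proof.
have [tDl tDr tZ] := @tens_balanced _ F A.
move=> s s'; elim/tensor_ind: t => [|t u IHt IHu|x a].
- by rewrite !raddf0 addr0.
- by rewrite !raddfB /= IHt IHu opprD addrACA.
- by rewrite !base_scale_tens mulrDl; apply: tDl.
Qed.

HB.instance Definition _ :=
  GRing.Zmodule_isLmodule.Build S (base_change phi A)
    base_scaleA base_scale1 base_scaleDr base_scaleDl.

Definition btens (x : S) (a : A) : base_change phi A := tens (x : F) a.

Lemma base_change_ind (X : base_change phi A -> Prop) :
    X 0 -> (forall t u, X t -> X u -> X (t - u)) ->
    (forall x a, X (btens x a)) ->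
  forall t, X t.
Proof. exact: tensor_ind. Qed.

Lemma btensZ (s x : S) a : s *: btens x a = btens (s * x) a.
Proof. exact: base_scale_tens. Qed.

Lemma btens_additive (a : A) : exists g : {additive S -> base_change phi A},
  forall x, g x = btens x a.
Proof.
have [tDl _ _] := @tens_balanced _ F A.
have btensDl (u v : S) : btens (u + v) a = btens u a + btens v a by exact: tDl.
have gB : zmod_morphism (btens^~ a).
  by move=> x y; apply: (addIr (btens y a)); rewrite -btensDl !subrK.
pose g : {additive S -> base_change phi A} := HB.pack (btens^~ a)
  (GRing.isZmodMorphism.Build S (base_change phi A) (btens^~ a) gB).
by exists g.
Qed.

Lemma base_change_ext (G : zmodType) (h h' : {additive base_change phi A -> G}) :
  (forall x a, h (btens x a) = h' (btens x a)) -> h =1 h'.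
Proof.
move=> hh'; elim/base_change_ind => [|t u IHt IHu|x a]; last exact: hh'.
  by rewrite !raddf0.
by rewrite !raddfB IHt IHu.
Qed.

Lemma btens_scaler (x : S) (r : R) a : btens x (r *: a) = btens (x * phi r) a.
Proof. by have [_ _ tZ] := @tens_balanced _ F A; rewrite [RHS]tZ. Qed.

Lemma base_change_linear (C : lmodType S)
    (h : {additive base_change phi A -> C}) :
  (forall s x a, h (btens (s * x) a) = s *: h (btens x a)) -> linear h.
Proof.
move=> hZ s t u; rewrite raddfD; congr (_ + _).
elim/base_change_ind: t => [|t v IHt IHv|x a].
- by rewrite !raddf0.
- by rewrite scalerBr raddfB IHt IHv -scalerBr -raddfB.
- by rewrite btensZ hZ.
Qed.

End BaseChange.

Arguments base_change {R S} phi A.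
Arguments btens {R S} phi {A} x a.

Section BaseChangeMap.
Context (R S : nzRingType) (phi : {rmorphism R -> S}).

Lemma base_map_linear (A B : lmodType R) (f : {linear A -> B}) :
  linear (tensor_map (rmod_via phi) f : base_change phi A -> base_change phi B).
Proof.
pose h : {additive base_change phi A -> base_change phi B} :=
  tensor_map (rmod_via phi) f.
apply: (base_change_linear (h := h)) => s x a.
have hE y b : h (btens phi y b) = btens phi y (f b) by exact: tensor_mapE.
by rewrite !hE btensZ.
Qed.

Definition base_map (A B : lmodType R) (f : {linear A -> B}) :
  {linear base_change phi A -> base_change phi B} :=
  linear_of (base_map_linear f).

End BaseChangeMap.

(** The right adjoint of base change, introduced to show that base change preserves projectivity. *)
Definition restrict (R S : nzRingType) (phi : {rmorphism R -> S})
  (B : lmodType S) : Type := B.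

Section Restriction.
Context (R S : nzRingType) (phi : {rmorphism R -> S}) (B : lmodType S).

HB.instance Definition _ := GRing.Zmodule.on (restrict phi B).

Definition restrict_scale (r : R) (b : restrict phi B) : restrict phi B :=
  phi r *: (b : B).

Lemma restrict_scaleA r s b :
  restrict_scale r (restrict_scale s b) = restrict_scale (r * s) b.
Proof. by rewrite /restrict_scale scalerA rmorphM. Qed.

Lemma restrict_scale1 : left_id 1 restrict_scale.
Proof. by move=> b; rewrite /restrict_scale rmorph1 scale1r. Qed.

Lemma restrict_scaleDr : right_distributive restrict_scale +%R.
Proof. by move=> r b c; apply: scalerDr. Qed.

Lemma restrict_scaleDl b : {morph restrict_scale^~ b : r s / r + s}.
Proof. by move=> r s; rewrite /restrict_scale rmorphD; apply: scalerDl. Qed.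

HB.instance Definition _ :=
  GRing.Zmodule_isLmodule.Build R (restrict phi B)
    restrict_scaleA restrict_scale1 restrict_scaleDr restrict_scaleDl.

End Restriction.

(** By adjunction [h] becomes the [R]-linear map [p |-> h (1 (x) p)] on [P]; this is lifted through
    [g], regarded as [R]-linear, and the lift [k] extends back by [x (x) p |-> x *: k p]. *)
Lemma base_change_projective (R S : nzRingType) (phi : {rmorphism R -> S})
    (P : lmodType R) :
  projective P -> projective (base_change phi P).
Proof.
move=> Pproj A B g h g_surj; pose F := rmod_via phi.
have [tDl tDr tZ] := @tens_balanced _ F P.
have gL : linear (g : restrict phi A -> restrict phi B).
  by move=> r x y; rewrite [LHS]linearP.
have hL : linear (fun p : P => h (btens phi 1 p) : restrict phi B).
  move=> r x y; rewrite /btens tDr linearD; congr (_ + _).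
  rewrite -tZ [RHS](esym (linearZ _ _)); congr (h _).
  by rewrite [RHS]btensZ mulr1 /btens; congr tens; apply: mul1r.
have [k kE] := Pproj _ _ (linear_of gL) (linear_of hL) g_surj.
have kbal : balanced (fun (x : F) p => (x : S) *: (k p : A)).
  split=> [x y p|x p q|r x p]; first exact: scalerDl.
    by rewrite linearD; apply: scalerDr.
  by rewrite linearZ [RHS]scalerA.
have [l lE] := tensor_lift_additive kbal.
have lL : linear (l : base_change phi P -> A).
  apply: (@base_change_linear _ _ phi P A l) => s x p.
  by rewrite [LHS]lE [l _]lE scalerA.
exists (linear_of lL); elim/base_change_ind => [|t u IHt IHu|x p].
- by rewrite !linear0.
- by rewrite !linearB IHt IHu.
rewrite [linear_of lL _]lE linearZ /= [g _]kE /= -[RHS]/(h (btens phi x p)).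
by rewrite -linearZ btensZ mulr1.
Qed.

Section BaseChangeResolution.
Context (R S : nzRingType) (phi : {rmorphism R -> S}) (N : lmodType R).
Hypothesis phi_flat : flat (rmod_via phi).
Context (P : proj_resolution N).

Definition base_res : proj_resolution (base_change phi N).
Proof.
apply: (@ProjResolution S (base_change phi N) (fun i => base_change phi (P i))
  (fun i => base_map phi (res_d P i)) (base_map phi (res_eps P))).
- by move=> i; apply: base_change_projective; apply: res_proj.
- by apply: tensor_map_surj; apply: res_surj.
- by apply: flat_exact => //; apply: res_exact0.
- by move=> i; apply: flat_exact => //; apply: res_exactS.
Defined.

Lemma base_res_length n : length_at_most P n -> length_at_most base_res n.
Proof.
move=> lP i lt_ni; elim/tensor_ind => [//|t u -> ->|x p]; first exact: subrr.
by rewrite (lP i _ p) // tens0r.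
Qed.

End BaseChangeResolution.

(** * Semidirect products and derivations *)

Lemma mring_ind (M : monoidType) (X : mring M -> Prop) :
    X 0 -> (forall x y, X x -> X y -> X (x - y)) -> (forall m, X << m >>) ->
  forall x, X x.
Proof. exact: malg_ind. Qed.

Definition semidirect (L : monoidType) (A : lmodType (mring L)) : Type :=
  (A * L)%type.

Section Semidirect.
Context (L : monoidType) (A : lmodType (mring L)).

HB.instance Definition _ := Choice.on (semidirect A).

Definition sd_mul (p q : semidirect A) : semidirect A :=
  (p.1 + (<< p.2 >> : mring L) *: q.1, (p.2 * q.2)%g).
Definition sd_one : semidirect A := (0, 1%g).

Lemma mring_mulU (l k : L) :
  (<< l >> : mring L) * (<< k >> : mring L) = << (l * k)%g >>.
Proof. exact: mring_mulUU. Qed.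

Lemma sd_mulA : associative sd_mul.
Proof.
move=> p q r; congr (_, _); last exact: mulgA.
by rewrite /= scalerDr scalerA mring_mulU addrA.
Qed.

Lemma sd_mul1l : left_id sd_one sd_mul.
Proof. by case=> a l; rewrite /sd_mul /= add0r scale1r mul1g. Qed.

Lemma sd_mul1r : right_id sd_one sd_mul.
Proof. by case=> a l; rewrite /sd_mul /= scaler0 addr0 mulg1. Qed.

HB.instance Definition _ :=
  isMonoid.Build (semidirect A) sd_mulA sd_mul1l sd_mul1r.

End Semidirect.

(* Derivations of [M] along [i : M -> L], the right action of [M] on [A] being
   trivial: they correspond to the lifts of [i] to [semidirect A]. *)
Definition derivation (M L : monoidType) (i : monoid_hom M L)
    (A : lmodType (mring L)) (f : M -> A) : Prop :=
  forall m n, f (m * n)%g = f m + (<< i m >> : mring L) *: f n.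

Section Derivations.
Context (M L : monoidType) (i : monoid_hom M L) (A : lmodType (mring L)).

Lemma derivation1 (f : M -> A) : derivation i f -> f 1%g = 0.
Proof.
move=> /(_ 1%g 1%g); rewrite mulg1 gmulf1 scale1r => f11.
by apply: (addrI (f 1%g)); rewrite addr0 -f11.
Qed.

Lemma derivation_hom (f : M -> A) : derivation i f ->
  exists h : monoid_hom M (semidirect A), forall m, h m = (f m, i m).
Proof.
move=> fD; pose h (m : M) : semidirect A := (f m, i m).
have hM : {morph h : m n / (m * n)%g} by move=> m n; rewrite /h fD gmulfM.
have h1 : h 1%g = 1%g by rewrite /h derivation1 // gmulf1.
pose hh : monoid_hom M (semidirect A) :=
  HB.pack h (isUMagmaMorphism.Build M (semidirect A) h (h1, hM)).
by exists hh.
Qed.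

End Derivations.

Section PushoutDerivations.
Context (W M1 M2 L : monoidType).
Context (j1 : monoid_hom W M1) (j2 : monoid_hom W M2).
Context (i1 : monoid_hom M1 L) (i2 : monoid_hom M2 L).
Hypothesis L_pushout : is_pushout j1 j2 i1 i2.
Context (A : lmodType (mring L)).

Lemma pushout_hom_ext (N : monoidType) (h h' : monoid_hom L N) :
  h \o i1 =1 h' \o i1 -> h \o i2 =1 h' \o i2 -> h =1 h'.
Proof.
move=> e1 e2; have [ij po] := L_pushout.
have [|k [_ _ k_uniq]] := po N (h' \o i1) (h' \o i2).
  by move=> w; congr (h' _); apply: ij.
by move=> l; rewrite (k_uniq h e1 e2) (k_uniq h').
Qed.

(** The pairs [(f1, i1)] and [(f2, i2)] are homomorphisms to [semidirect A] that agree on [W]; the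
    induced homomorphism on [L] has [D] as its first component. *)
Lemma pushout_derivation (f1 : M1 -> A) (f2 : M2 -> A) :
  derivation i1 f1 -> derivation i2 f2 -> f1 \o j1 =1 f2 \o j2 ->
  exists D : L -> A, [/\ derivation idfun D, D \o i1 =1 f1 & D \o i2 =1 f2].
Proof.
move=> /derivation_hom[h1 h1E] /derivation_hom[h2 h2E] f12.
have [ij po] := L_pushout.
have [|h [h_i1 h_i2 _]] := po _ h1 h2.
  by move=> w; have /= e := ij w; have /= e' := f12 w; rewrite /= h1E h2E e e'.
(* The second component is an endomorphism of [L] restricting to [i1] and [i2], hence the identity;
   so the first component is a derivation along [idfun]. *)
have h_snd l : (h l).2 = l.
  pose p (l : L) := (h l).2.
  have pM : {morph p : l k / (l * k)%g} by move=> l' k; rewrite /p gmulfM.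
  have p1 : p 1%g = 1%g by rewrite /p gmulf1.
  pose pp : monoid_hom L L := 
    HB.pack p (isUMagmaMorphism.Build L L p (p1, pM)).
  apply: (@pushout_hom_ext _ pp idfun) => m; rewrite /= /p.
    by have /= -> := h_i1 m; rewrite h1E.
  by have /= -> := h_i2 m; rewrite h2E.
exists (fun l => (h l).1); split=> [l k|m|m] /=.
- by rewrite gmulfM /= h_snd.
- by have /= -> := h_i1 m; rewrite h1E.
- by have /= -> := h_i2 m; rewrite h2E.
Qed.

(** The homomorphisms [l |-> (D l, l)] and [l |-> (D' l, l)] are determined by their restrictions to
    [M1] and [M2]. *)
Lemma pushout_derivation_ext (D D' : L -> A) :
  derivation idfun D -> derivation idfun D' ->
  D \o i1 =1 D' \o i1 -> D \o i2 =1 D' \o i2 -> D =1 D'.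
Proof.
move=> /derivation_hom[h hE] /derivation_hom[h' h'E] e1 e2 l.
have: h l = h' l.
  apply: pushout_hom_ext => m; rewrite /= hE h'E; congr (_, _).
    exact: e1.
  exact: e2.
by rewrite hE h'E => -[].
Qed.

End PushoutDerivations.

(** * Trivial modules induced to [mring L] *)

Lemma mring_additive_ext (M : monoidType) (G : zmodType)
    (f f' : {additive mring M -> G}) :
  (forall m, f << m >> = f' << m >>) -> f =1 f'.
Proof. exact: malg_additive_ext. Qed.

Lemma mring_additive (M : monoidType) (G : zmodType) (b : M -> G) :
  exists B : {additive mring M -> G}, forall m, B << m >> = b m.
Proof.
pose B : {additive mring M -> G} := malg_ext b.
by exists B => m; apply: malg_extU.
Qed.

Lemma trivial_modZ (M : monoidType) (r : mring M) (n : trivial_mod M) :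
  r *: n = mring_aug r * (n : int).
Proof. by []. Qed.

Lemma mring_augU (M : monoidType) (m : M) : mring_aug (<< m >> : mring M) = 1.
Proof. exact: malg_extU. Qed.

(** Supplies the balancedness of [(x, n) |-> B x *~ n]: invariance under basis elements extends
    additively to an action through the augmentation. *)
Lemma mring_invariant (M L : monoidType) (G : zmodType)
    (phi : {rmorphism mring M -> mring L}) (e : {additive mring M -> int})
    (B : {additive mring L -> G}) :
  (forall m, e << m >> = 1) ->
  (forall l m, B ((<< l >> : mring L) * phi << m >>) = B << l >>) ->
  forall x r, B (x * phi r) = B x *~ e r.
Proof.
move=> eU B_inv x r; elim/mring_ind: r => [|r s IHr IHs|m].
- by rewrite (rmorph0 phi) (raddf0 e) mulr0 raddf0.
- by rewrite (rmorphB phi) mulrBr (raddfB B) (raddfB e) IHr IHs mulrzBr.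
rewrite eU mulr1z; elim/mring_ind: x => [|x y IHx IHy|l]; last exact: B_inv.
  by rewrite mul0r raddf0.
by rewrite mulrBl !(raddfB B) IHx IHy.
Qed.

(* The universal property of [V = ZL (x)_M Z] with [c l = l (x) 1]: additively it
   is free on the quotient of [L] by the equivalence relation generated by
   [l * i m ~ l]. *)
Definition coset_module (M L : monoidType) (i : monoid_hom M L)
    (V : lmodType (mring L)) (c : L -> V) : Prop :=
  [/\ forall l m, c (l * i m)%g = c l,
      forall k l, (<< k >> : mring L) *: c l = c (k * l)%g,
      forall (G : zmodType) (h h' : {additive V -> G}),
        (forall l, h (c l) = h' (c l)) -> h =1 h' &
      forall (G : zmodType) (b : L -> G), (forall l m, b (l * i m)%g = b l) ->
        exists h : {additive V -> G}, forall l, h (c l) = b l].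

Lemma base_change_coset_module (M L : monoidType) (i : monoid_hom M L) :
  exists c : L -> base_change (mring_map i) (trivial_mod M), coset_module i c.
Proof.
pose phi : {rmorphism mring M -> mring L} := mring_map i.
have phiU m : phi << m >> = << i m >> by exact: malg_extU.
pose one : trivial_mod M := 1.
have [g gE] := btens_additive phi one.
exists (fun l => g << l >>); split.
- move=> l m; rewrite -mring_mulU -phiU !gE -btens_scaler.
  by congr btens; rewrite trivial_modZ mring_augU mul1r.
- by move=> k l; rewrite !gE btensZ mring_mulU.
- move=> G h h' hh'; apply: base_change_ext => x n.
  (* As a scalar multiple of [one], [n] moves across the tensor sign, so it suffices to compare [h]
     and [h'] on the image of [g]. *)
  have -> : n = (n : int)%:~R *: one.
    by rewrite trivial_modZ rmorph_int mulr1 intz.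
  rewrite btens_scaler -gE.
  exact: (mring_additive_ext (f := h \o g) (f' := h' \o g)).
- move=> G b b_inv; have [B BE] := mring_additive b.
  have B_aug : forall x r, B (x * phi r) = B x *~ mring_aug r.
    apply: (mring_invariant (e := @mring_aug M)) => [m|l m].
      exact: mring_augU.
    by rewrite phiU mring_mulU !BE.
  have Bbal : balanced (fun (x : rmod_via phi) (n : trivial_mod M) =>
      B x *~ (n : int)).
    split=> [x y n|x m n|r x n]; first by rewrite raddfD mulrzDl.
      exact: mulrzDr.
    by rewrite [B _]B_aug -mulrzA.
  have [h hE] := tensor_lift_additive Bbal.
  by exists h => l; rewrite gE [LHS]hE BE.
Qed.

(** The universal property gives only an additive map. For fixed [s], both [h (s *: t)] and
    [s *: h t] are additive in [t], so they are compared on the [c l], by induction on [s]. *)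
Lemma coset_lift_linear (M L : monoidType) (i : monoid_hom M L)
    (V A : lmodType (mring L)) (c : L -> V) (b : L -> A) :
  coset_module i c -> (forall l m, b (l * i m)%g = b l) ->
  (forall k l, b (k * l)%g = (<< k >> : mring L) *: b l) ->
  exists h : {linear V -> A}, forall l, h (c l) = b l.
Proof.
move=> [_ c_scale c_ext c_lift] b_inv bM; have [h hE] := c_lift _ _ b_inv.
have hZ s t : h (s *: t) = s *: h t.
  pose hs : {additive V -> A} := h \o ( *:%R s).
  pose sh : {additive V -> A} := ( *:%R s) \o h.
  apply: (c_ext _ hs sh) => l; rewrite /= hE.
  elim/mring_ind: s {hs sh} => [|x y IHx IHy|k]; first by rewrite !scale0r raddf0.
    by rewrite !scalerBl raddfB /= IHx IHy.
  by rewrite c_scale hE bM.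
have hL : linear h by move=> s t u; rewrite raddfD /= hZ.
by exists (linear_of hL).
Qed.

(** * The exact sequence of the amalgam *)

Section MayerVietoris.
Context (W M1 M2 L : monoidType).
Context (j1 : monoid_hom W M1) (j2 : monoid_hom W M2).
Context (i1 : monoid_hom M1 L) (i2 : monoid_hom M2 L).
Hypothesis L_pushout : is_pushout j1 j2 i1 i2.
Context (E V1 V2 : lmodType (mring L)).
Context (q : L -> E) (q1 : L -> V1) (q2 : L -> V2).
Hypothesis q_coset : coset_module (i1 \o j1) q.
Hypothesis q1_coset : coset_module i1 q1.
Hypothesis q2_coset : coset_module i2 q2.

Lemma coset_augmentation (M : monoidType) (i : monoid_hom M L)
    (V : lmodType (mring L)) (c : L -> V) : coset_module i c ->
  exists e : {linear V -> trivial_mod L}, forall l, e (c l) = 1.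
Proof.
move=> c_coset; apply: (coset_lift_linear c_coset) => // k l.
by rewrite trivial_modZ mring_augU mulr1.
Qed.

(** Here [alpha = (a1, a2)] and [beta (u, v) = e1 u - e2 v]. The splittings [p1] and [p2] are built
    as additive maps only, which suffices because exactness concerns the underlying groups. *)
Lemma mayer_vietoris :
  exists (alpha : {linear E -> (V1 * V2)%type})
         (beta : {linear (V1 * V2)%type -> trivial_mod L}),
  [/\ injective alpha, forall y, beta y = 0 <-> exists x, alpha x = y &
      forall z, exists y, beta y = z].
Proof.
have [ij _] := L_pushout.
have [q_inv q_scale q_ext q_lift] := q_coset.
have [q1_inv q1_scale q1_ext q1_lift] := q1_coset.
have [q2_inv q2_scale q2_ext q2_lift] := q2_coset.
have [a1 a1E] : exists a1 : {linear E -> V1}, forall l, a1 (q l) = q1 l.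
  by apply: (coset_lift_linear q_coset) => [l w|k l]; first exact: q1_inv.
have [a2 a2E] : exists a2 : {linear E -> V2}, forall l, a2 (q l) = q2 l.
  apply: (coset_lift_linear q_coset) => [l w|k l] //.
  by have /= -> := ij w; apply: q2_inv.
have [e1 e1E] := coset_augmentation q1_coset.
have [e2 e2E] := coset_augmentation q2_coset.
(* The principal derivation of [q 1%g] on [M1] and zero on [M2] agree on [W], because [q] is right
   invariant under [W]. *)
have [D [D_der D1 D2]] : exists D : L -> E,
    [/\ derivation idfun D, forall m, D (i1 m) = q (i1 m) - q 1%g
      & forall m, D (i2 m) = 0].
  apply: (pushout_derivation L_pushout (f2 := fun=> 0)).
  - move=> m n; rewrite scalerBr !q_scale mulg1 gmulfM.
    by rewrite [RHS]addrC addrA subrK.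
  - by move=> m n; rewrite scaler0 addr0.
  - move=> w /=; rewrite -[i1 (j1 w)]mul1g.
    by rewrite [q _](q_inv 1%g w) subrr.
(* [D] is right invariant under [M2] and so descends to [V2]. Under [M1] it changes exactly as [q]
   does, so [q - D] descends to [V1]. *)
have D_mulr2 l m : D (l * i2 m)%g = D l by rewrite D_der D2 scaler0 addr0.
have D_mulr1 l m : D (l * i1 m)%g = D l + (q (l * i1 m)%g - q l).
  by rewrite D_der D1 scalerBr !q_scale mulg1.
have [p1 p1E] : exists p : {additive V1 -> E}, forall l, p (q1 l) = q l - D l.
  apply: q1_lift => l m; rewrite D_mulr1.
  by rewrite opprD opprB addrC -addrA subrK addrC.
have [p2 p2E] : exists p : {additive V2 -> E}, forall l, p (q2 l) = D l.
  exact: q2_lift.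
(* The derivation [a1 \o D] vanishes on [M1] because [q1] is invariant there, and on [M2] because
   [D] does. *)
have a1D l : a1 (D l) = 0.
  apply: (pushout_derivation_ext L_pushout (D := a1 \o D) (D' := fun=> 0)).
  - by move=> m n; rewrite /= D_der linearD linearZ.
  - by move=> m n; rewrite scaler0 addr0.
  - move=> m; rewrite /= D1 linearB /= !a1E -[i1 m]mul1g q1_inv.
    exact: subrr.
  - by move=> m; rewrite /= D2 linear0.
(* The principal derivation of [q2 1%g] agrees with [a2 \o D] on [M1] by the choice of [D], and both
   vanish on [M2]. *)
have a2D l : a2 (D l) = q2 l - q2 1%g.
  apply: (pushout_derivation_ext L_pushout (D := a2 \o D)
    (D' := fun k => q2 k - q2 1%g)).
  - by move=> m n; rewrite /= D_der linearD linearZ.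
  - move=> m n; rewrite scalerBr !q2_scale mulg1.
    by rewrite [RHS]addrC addrA subrK.
  - by move=> m; rewrite /= D1 linearB /= !a2E.
  - move=> m; rewrite /= D2 linear0 -[i2 m]mul1g q2_inv.
    by rewrite subrr.
have alphaL : linear (fun x => (a1 x, a2 x)).
  by move=> r x y; congr (_, _); rewrite /= linearP.
have betaL : linear (fun y : V1 * V2 => e1 y.1 - e2 y.2).
  by move=> r x y; rewrite /= !linearP addrACA -scalerDr.
have pK : (p1 \o a1) \+ (p2 \o a2) =1 idfun.
  by apply: q_ext => l; rewrite /= a1E a2E p1E p2E subrK.
have a1p1 : a1 \o p1 =1 idfun.
  by apply: q1_ext => l; rewrite /= p1E linearB /= a1E a1D subr0.
have a1p2 : a1 \o p2 =1 \0 by apply: q2_ext => l; rewrite /= p2E a1D.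
(* The error term: [alpha] applied to [p1 u + p2 v] gives [(u, v)] plus [n (beta (u, v))] in the
   second component, which vanishes on the kernel of [beta]. *)
pose n1 (k : trivial_mod L) : V2 := q2 1%g *~ k.
have n1B : zmod_morphism n1 by move=> k l; apply: mulrzBr.
pose n : {additive trivial_mod L -> V2} :=
  HB.pack n1 (GRing.isZmodMorphism.Build _ _ n1 n1B).
have a2p1 : a2 \o p1 =1 n \o e1.
  apply: q1_ext => l; rewrite /= p1E linearB /= a2E a2D e1E subKr.
  by rewrite /n1 mulr1z.
have a2p2 : a2 \o p2 =1 idfun \- (n \o e2).
  by apply: q2_ext => l; rewrite /= p2E a2D e2E.
have eE x : e1 (a1 x) = e2 (a2 x).
  have: e1 \o a1 =1 e2 \o a2.
    by apply: q_ext => l; rewrite /= a1E a2E e1E e2E.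
  exact.
exists (linear_of alphaL), (linear_of betaL); split.
- by move=> x y [xy1 xy2]; rewrite -[x]pK -[y]pK /= xy1 xy2.
- move=> [u v] /=; split=> [/subr0_eq euv|[x [<- <-]]]; last first.
    by rewrite eE subrr.
  exists (p1 u + p2 v); congr (_, _); rewrite linearD /=.
    by rewrite [a1 _]a1p1 [a1 _]a1p2 addr0.
  by rewrite [a2 _]a2p1 [a2 _]a2p2 /= euv addrC subrK.
- move=> z; exists (q1 1%g *~ (z : int), 0); rewrite /= linear0 subr0.
  by rewrite raddfMz /= e1E intz.
Qed.

End MayerVietoris.

Theorem theorem4p14 (W M1 M2 L : monoidType)
    (j1 : monoid_hom W M1) (j2 : monoid_hom W M2)
    (j1_inj : injective j1) (j2_inj : injective j2)
    (i1 : monoid_hom M1 L) (i2 : monoid_hom M2 L)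
    (L_pushout : is_pushout j1 j2 i1 i2)
    (flat_M1 : flat (rmod_via (mring_map i1)))
    (flat_M2 : flat (rmod_via (mring_map i2)))
    (flat_W : flat (rmod_via (mring_map (i1 \o j1))))
    (d : nat) (d_ge1 : (1 <= d)%N)
    (cd_M1 : left_cd_le M1 d) (cd_M2 : left_cd_le M2 d)
    (cd_W : left_cd_le W (d - 1)) :
  left_cd_le L d.
Proof.
have [P1 lP1] := cd_M1; have [P2 lP2] := cd_M2.
(* With [d] rewritten as [d.+1], the bound for [W] is [d], and the degree shift in the cone brings
   it to [d.+1]. *)
case: d d_ge1 lP1 lP2 cd_W {cd_M1 cd_M2} => // d _ lP1 lP2.
rewrite subn1 => -[P lP].
have [q q_coset] := base_change_coset_module (i1 \o j1).
have [q1 q1_coset] := base_change_coset_module i1.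
have [q2 q2_coset] := base_change_coset_module i2.
have [alpha [beta [alpha_inj exact_mid beta_surj]]] :=
  mayer_vietoris L_pushout q_coset q1_coset q2_coset.
apply: (mapping_cone alpha_inj exact_mid beta_surj (P := base_res flat_W P)
  (Q := prod_res (base_res flat_M1 P1) (base_res flat_M2 P2))).
  exact: base_res_length.
by apply: prod_res_length; apply: base_res_length.
Qed.
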